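(* If $G$ is a graph, then $\mathrm{gp}(G)\le \mathrm{gp}(D(G))\le 2\,\mathrm{gp}(G)$, and both bounds are sharp (i.e., each is attained with equality by some graph). Moreover, $\mathrm{gp}(D(G))=2\,\mathrm{gp}(G)$ if and only if the gp-sets of $D(G)$ are of the form $X\cup X'$, where $X$ is an independent gp-set of $G$ and $X'=\{u': u\in X\}$.
   Context: All graphs are finite and simple. The double graph $D(G)$ is obtained from the disjoint union of $G$ and a copy $G'$ with $V(G')=\{u': u\in V(G)\}$ by joining each $u\in V(G)$ to all neighbors of $u'$ in $G'$ and each $u'$ to all neighbors of $u$ in $G$. A set of vertices is a general position set if no three of its vertices lie on a common shortest path; $\mathrm{gp}(H)$ is the maximum size of a general position set of $H$, and a general position set of that maximum size is called a gp-set. *)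

(* Defs.v *)
From mathcomp Require Import all_boot.
From mathcomp Require Import boolp.

Set Implicit Arguments.
Unset Strict Implicit.
Unset Printing Implicit Defensive.

Record sgraph := SGraph {
  vertex :> finType;
  edge : rel vertex;
  edge_sym : symmetric edge;
  edge_irr : irreflexive edge
}.

Section GeneralPosition.
Variable G : sgraph.

(* [x :: p] is a shortest path from [x] to [last x p]. Minimality is over all
   walks with these ends, so the vertices of [x :: p] are distinct. *)
Definition shortest_path (x : G) (p : seq G) : Prop :=
  path (@edge G) x p /\
  (forall q : seq G, path (@edge G) x q -> last x q = last x p ->
     size p <= size q).

Definition on_common_shortest_path (u v w : G) : Prop :=
  exists (x : G) (p : seq G),
    shortest_path x p /\ [/\ u \in x :: p, v \in x :: p & w \in x :: p].

Definition general_position (S : {set G}) : Prop :=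
  forall u v w : G, u \in S -> v \in S -> w \in S ->
    u != v -> u != w -> v != w -> ~ on_common_shortest_path u v w.

Definition gp : nat := \max_(S : {set G} | `[< general_position S >]) #|S|.

Definition gp_set (S : {set G}) : Prop := general_position S /\ #|S| = gp.

Definition independent (S : {set G}) : Prop :=
  forall u v : G, u \in S -> v \in S -> ~~ edge u v.

End GeneralPosition.

Section DoubleGraph.
Variable G : sgraph.

(* [inl u] is the vertex u of G and [inr u] is its copy u'. *)
Definition double_edge (a b : G + G) : bool :=
  match a, b with
  | inl u, inl v => edge u v
  | inr u, inr v => edge u v
  | inl u, inr v => edge u v (* v' is a neighbor of u' in G' *)
  | inr u, inl v => edge u v (* v is a neighbor of u in G *)
  end.

Lemma double_edge_sym : symmetric double_edge.
Proof. by move=> [u|u] [v|v]; apply: edge_sym. Qed.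

Lemma double_edge_irr : irreflexive double_edge.
Proof. by move=> [u|u]; apply: edge_irr. Qed.

Definition double_graph : sgraph := SGraph double_edge_sym double_edge_irr.

Definition orig (u : G) : double_graph := inl u.
Definition copy (u : G) : double_graph := inr u.

End DoubleGraph.

(* Main.v *)
(** Let [proj] be the projection of [D(G)] onto [G]. A map [s] that chooses one
    of the two lifts of every vertex preserves shortest paths, so the projection
    of a general position set of [D(G)] is in general position in [G]. As [proj]
    is at most two-to-one, [gp (D(G)) <= 2 * gp G], and equality forces a gp-set
    of [D(G)] to be [X :|: X'] for its projection [X], a gp-set of [G]. This [X]
    is independent, since adjacent [u], [v] in [X] would give the shortest path
    [u], [v], [u']. Conversely, a shortest path of [D(G)] projects to a shortest
    path of [G] unless its ends are twins; in that case it has at most three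
    vertices, two of which are twins, so three vertices of [G] do not lie on it.
    The bounds are attained by [K_2] and [K_1]. *)

Require Import Defs.
From mathcomp Require Import all_boot.
From mathcomp Require Import boolp.

Set Implicit Arguments.
Unset Strict Implicit.
Unset Printing Implicit Defensive.

Section GeneralPositionNumber.
Variable G : sgraph.

Lemma leq_gp (S : {set G}) : general_position S -> #|S| <= gp G.
Proof. by move=> gpS; apply: leq_bigmax_cond; apply/asboolP. Qed.

Lemma gp_set_exists : exists S : {set G}, gp_set S.
Proof.
(* The empty set makes the family nonempty, so the maximum is attained and is not the default 0 of
   an empty maximum. *)
have gp0 : 0 < #|[pred S : {set G} | `[< general_position S >]]|.
  apply/card_gt0P; exists set0; rewrite inE; apply/asboolP => u v w.
  by rewrite inE.
have [S /asboolP gpS eqS] := eq_bigmax_cond (fun S : {set G} => #|S|) gp0.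
by exists S.
Qed.

Lemma general_position_card_le2 (S : {set G}) :
  #|S| <= 2 -> general_position S.
Proof.
move=> S2 u v w uS vS wS uv uw vw; exfalso.
suff : 2 < #|S| by rewrite ltnNge S2.
by apply/card_gt2P; exists u, v, w; split; split; rewrite // eq_sym.
Qed.

Lemma gp_le_card : gp G <= #|G|.
Proof. by have [S [_ <-]] := gp_set_exists; apply: max_card. Qed.

End GeneralPositionNumber.

(** * Lifting through sections of the projection; the upper bound *)

Section Double.
Variable G : sgraph.
Local Notation D := (double_graph G).

Definition proj (a : D) : G := match a with inl u => u | inr u => u end.

Lemma orig_inj : injective (@orig G).
Proof. by move=> u v []. Qed.

Lemma edge_proj (a b : D) : edge a b = edge (proj a) (proj b).
Proof. by case: a b => [u|u] [v|v]. Qed.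

Lemma path_proj (a : D) (p : seq D) :
  path (@edge D) a p = path (@edge G) (proj a) (map proj p).
Proof. by elim: p a => //= b p IHp a; rewrite IHp -edge_proj. Qed.

(** A competing walk in [D] projects to a walk in [G] of the same length between the projected ends,
    so minimality carries over. *)
Lemma shortest_path_section (s : G -> D) (x : G) (p : seq G) :
  cancel s proj -> shortest_path x p -> shortest_path (s x) (map s p).
Proof.
move=> sK [xp min_p]; split=> [|q]; first by rewrite path_proj (mapK sK) sK.
rewrite path_proj sK last_map size_map => xq eq_last.
rewrite -(size_map proj q); apply: min_p => //.
by rewrite -{1}(sK x) last_map eq_last sK.
Qed.

Lemma on_common_shortest_path_section (s : G -> D) (u v w : G) :
  cancel s proj -> on_common_shortest_path u v w ->
  on_common_shortest_path (s u) (s v) (s w).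
Proof.
move=> sK [x [p [xp [up vp wp]]]]; exists (s x), (map s p).
split; first exact: shortest_path_section.
by split; rewrite -map_cons map_f.
Qed.

Lemma general_position_proj (S : {set D}) :
  general_position S -> general_position (proj @: S).
Proof.
move=> gpS u v w uS vS wS uv uw vw.
(* This section picks a lift inside [S] whenever there is one; the value [copy x] outside the
   projection is arbitrary. *)
pose s x : D := if orig x \in S then orig x else copy x.
have sK : cancel s proj by move=> x; rewrite /s; case: ifP.
have sS x : x \in proj @: S -> s x \in S.
  case/imsetP=> -[y|y] yS ->; rewrite /s; first by rewrite yS.
  by case: ifP.
have s_inj := can_inj sK.
move/(on_common_shortest_path_section sK).
by apply: gpS; rewrite ?sS ?(inj_eq s_inj).
Qed.

Lemma sub_doubled_proj (S : {set D}) :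
  S \subset (@orig G @: (proj @: S)) :|: (@copy G @: (proj @: S)).
Proof.
apply/subsetP=> -[u|u] uS; apply/setUP; [left|right].
  by apply: imset_f; apply/imsetP; exists (orig u).
by apply: imset_f; apply/imsetP; exists (copy u).
Qed.

Lemma card_doubled (X : {set G}) :
  #|(@orig G @: X) :|: (@copy G @: X)| = 2 * #|X|.
Proof.
rewrite cardsU !card_imset; try by move=> x y [].
rewrite (_ : _ :&: _ = set0) ?cards0 ?subn0 ?mul2n ?addnn //.
apply/setP=> a; rewrite !inE; apply/negP=> /andP[].
by case/imsetP=> x _ ->; case/imsetP.
Qed.

Lemma gp_double_le : gp D <= 2 * gp G.
Proof.
have [S [gpS <-]] := gp_set_exists D.
apply: leq_trans (subset_leq_card (sub_doubled_proj S)) _.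
by rewrite card_doubled leq_mul2l /=; apply/leq_gp/general_position_proj.
Qed.

(** * Projecting shortest paths; the lower bound *)

Lemma lift_path (a b : D) (q : seq G) :
  path (@edge G) (proj a) q -> last (proj a) q = proj b -> 0 < size q ->
  exists r : seq D,
    [/\ path (@edge D) a r, last a r = b & size r = size q].
Proof.
case/lastP: q => // q y aq; rewrite last_rcons => eq_y _.
(* Adjacency in [D] depends only on projections, so inner vertices may be lifted at will and the
   last one chosen as [b]. An empty [q] leaves no such choice: [a] and [b] could be distinct
   twins. *)
exists (rcons (map (@orig G) q) b).
rewrite last_rcons !size_rcons size_map; split=> //.
by rewrite path_proj map_rcons mapK // -eq_y.
Qed.

Lemma shortest_path_proj (a : D) (p : seq D) :
  proj a != proj (last a p) -> shortest_path a p ->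
  shortest_path (proj a) (map proj p).
Proof.
move=> neq [ap min_p]; split=> [|q aq]; first by rewrite -path_proj.
rewrite last_map size_map => eq_last.
have q_gt0 : 0 < size q.
  by case: q {aq} eq_last => //= eq_last; rewrite eq_last eqxx in neq.
by have [r [ar last_r <-]] := lift_path aq eq_last q_gt0; apply: min_p.
Qed.

Lemma shortest_path_twin_size (a : D) (p : seq D) :
  proj a = proj (last a p) -> shortest_path a p -> size p <= 2.
Proof.
case: p => // b p /= eq_a [+ min_p]; rewrite path_proj /= => /andP[ab _].
(* The first neighbor [b] of [a] is also adjacent to the other end, which has the same projection as
   [a]. *)
apply: (min_p [:: b; last b p]) => //.
by rewrite path_proj /= ab edge_sym -eq_a ab.
Qed.

Lemma on_common_shortest_path_orig (u v w : G) :
  u != v -> u != w -> v != w ->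
  on_common_shortest_path (orig u) (orig v) (orig w) ->
  on_common_shortest_path u v w.
Proof.
move=> uv uw vw [a [p [ap [ua va wa]]]].
have [eq_a|neq_a] := eqVneq (proj a) (proj (last a p)); last first.
  exists (proj a), (map proj p); split; first exact: shortest_path_proj.
  by rewrite -map_cons; split; [move: ua | move: va | move: wa];
    move/(map_f proj).
have uniq_s : uniq [:: orig u; orig v; orig w].
  by rewrite /= !inE !(inj_eq orig_inj)
    (negPf uv) (negPf uw) (negPf vw).
have sub_s : {subset [:: orig u; orig v; orig w] <= a :: p}.
  by move=> b; rewrite !inE => /or3P[] /eqP->.
have size_s : size (a :: p) <= size [:: orig u; orig v; orig w].
  exact: shortest_path_twin_size ap.
(* The three given vertices exhaust the path, so all its vertices lie in the original copy. Ends
   with equal projections then coincide, and minimality against the empty walk forces [p] to be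
   empty, too short for three vertices. *)
have [_ eq_s] := uniq_min_size uniq_s sub_s size_s.
have orig_s b : b \in a :: p -> b = orig (proj b).
  by rewrite -eq_s !inE => /or3P[] /eqP->.
have eq_last : a = last a p.
  apply: etrans (orig_s _ (mem_head a p)) _.
  by rewrite eq_a -(orig_s _ (mem_last a p)).
have [_ /(_ [::] isT eq_last)] := ap.
have := uniq_leq_size uniq_s sub_s.
by case: (p).
Qed.

Lemma general_position_orig (S : {set G}) :
  general_position S -> general_position (@orig G @: S).
Proof.
move=> gpS _ _ _ /imsetP[u uS ->] /imsetP[v vS ->] /imsetP[w wS ->].
rewrite !(inj_eq orig_inj) => uv uw vw.
by move/on_common_shortest_path_orig => /(_ uv uw vw); apply: gpS.
Qed.

Lemma gp_le_double : gp G <= gp D.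
Proof.
have [S [gpS <-]] := gp_set_exists G.
rewrite -(card_imset (mem S) orig_inj).
exact/leq_gp/general_position_orig.
Qed.

(** * Paths between twins and the equality case *)

Lemma shortest_path_twins (u : G) (b : D) :
  edge u (proj b) -> shortest_path (orig u) [:: b; copy u].
Proof.
move=> ub; split; first by rewrite path_proj /= ub edge_sym ub.
(* The empty walk misses [copy u], and a single edge between twins would project to a loop. *)
by case=> [|c [|d q]] //; rewrite path_proj /= => /andP[uc _] eq_c;
  rewrite eq_c edge_irr in uc.
Qed.

Lemma doubled_independent (X : {set G}) :
  general_position ((@orig G @: X) :|: (@copy G @: X)) -> independent X.
Proof.
move=> gpX u v uX vX; apply/negP=> uv.
have origX x : x \in X -> orig x \in (@orig G @: X) :|: (@copy G @: X).
  by move=> xX; rewrite inE imset_f.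
apply: (gpX (orig u) (orig v) (copy u)); rewrite ?origX //.
- by rewrite inE orbC imset_f.
- by apply: contraTneq uv => -[->]; rewrite edge_irr.
exists (orig u), [:: orig v; copy u]; split; first exact: shortest_path_twins.
by rewrite !inE !eqxx !orbT.
Qed.

Lemma gp_double_eq :
  gp D = 2 * gp G <->
  (forall S : {set D}, gp_set S ->
     exists X : {set G},
       [/\ gp_set X, independent X & S = (@orig G @: X) :|: (@copy G @: X)]).
Proof.
split=> [eq_gp S [gpS cardS]|gp_form]; last first.
  (* The hypothesis speaks of all gp-sets of [D]; its use needs at least one to exist. *)
  have [S gpS] := gp_set_exists D.
  have [X [[_ <-] _ defS]] := gp_form S gpS.
  by case: gpS => _ <-; rewrite defS card_doubled.
have gpX := general_position_proj gpS.
have defS : S = (@orig G @: (proj @: S)) :|: (@copy G @: (proj @: S)).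
  apply/eqP; rewrite eqEcard sub_doubled_proj card_doubled cardS eq_gp.
  by rewrite leq_mul2l leq_gp.
exists (proj @: S); split=> //; last by apply: doubled_independent; rewrite -defS.
split=> //; apply/eqP.
by rewrite -(eqn_pmul2l (isT : 0 < 2)) -card_doubled -defS cardS eq_gp.
Qed.

End Double.

(** * Sharpness of both bounds *)

Definition complete_graph (T : finType) : sgraph :=
  @SGraph T (fun x y => x != y) (fun x y => congr1 negb (eq_sym x y))
    (fun x => congr1 negb (eqxx x)).

Lemma gp_complete_bool :
  gp (double_graph (complete_graph bool)) = gp (complete_graph bool).
Proof.
apply/eqP; rewrite eqn_leq gp_le_double andbT; apply: (@leq_trans 2).
  have [S [gpS <-]] := gp_set_exists (double_graph (complete_graph bool)).
  rewrite leqNgt; apply/card_gt2P => -[a [b [c [[aS bS cS] [ab bc ca]]]]].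
  apply: (gpS a b c) => //; first by rewrite eq_sym.
  (* The double of [K_2] is a 4-cycle: among any three of its vertices two are twins, and the third
     lies between them. *)
  have common (u : complete_graph bool) (d : double_graph _) : u != proj d ->
      [/\ a \in [:: orig u; d; copy u], b \in [:: orig u; d; copy u] &
          c \in [:: orig u; d; copy u]] -> on_common_shortest_path a b c.
    by exists (orig u), [:: d; copy u]; split; first exact: shortest_path_twins.
  case: a b c ab bc ca {aS bS cS} common => [[]|[]] [[]|[]] [[]|[]] //= _ _ _ common;
  first [ by apply: (common true (inl false)) | by apply: (common true (inr false))
        | by apply: (common false (inl true)) | by apply: (common false (inr true)) ].
rewrite -[X in X <= _]card_bool -cardsT; apply/leq_gp/general_position_card_le2.
by rewrite cardsT card_bool.
Qed.

Lemma gp_complete_unit :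
  gp (double_graph (complete_graph unit)) = 2 * gp (complete_graph unit).
Proof.
apply/eqP; rewrite eqn_leq gp_double_le /=; apply: (@leq_trans 2).
  by rewrite (leq_mul2l 2 _ 1) (leq_trans (gp_le_card _)) ?card_unit.
have card2 : #|[set: double_graph (complete_graph unit)]| = 2.
  by rewrite cardsT card_sum card_unit.
by rewrite -card2; apply/leq_gp/general_position_card_le2; rewrite card2.
Qed.

Theorem theorem4p2 :
  (forall G : sgraph, gp G <= gp (double_graph G) <= 2 * gp G) /\
  (exists G : sgraph, 0 < #|vertex G| /\ gp (double_graph G) = gp G) /\
  (exists G : sgraph, 0 < #|vertex G| /\ gp (double_graph G) = 2 * gp G) /\
  (forall G : sgraph,
     gp (double_graph G) = 2 * gp G <->
     (forall S : {set double_graph G}, gp_set S ->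
        exists X : {set G},
          [/\ gp_set X, independent X &
              S = (@orig G @: X) :|: (@copy G @: X)])).
Proof.
split; first by move=> G; rewrite gp_le_double gp_double_le.
split.
  by exists (complete_graph bool); rewrite card_bool; split; last exact: gp_complete_bool.
split; last by move=> G; apply: gp_double_eq.
by exists (complete_graph unit); rewrite card_unit; split; last exact: gp_complete_unit.
Qed.
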